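(* Let $G$ be a simply connected Lie group with Lie algebra $\mathfrak{g}$, let $\nabla$ be a left invariant flat torsion free connection on $G$ and let $k^+$ be a left invariant pseudo-Riemannian metric on $G$. Let $[\cdot,\cdot]_\ast$, $\omega$, $j$ and $\cdot^H$ be the Lie bracket, bilinear form, linear complex structure and product on $\mathfrak{g}\oplus\mathfrak{g}^\ast$ constructed from $(G,\nabla,k^+)$ as described in the context. Then the quadruple $(\mathfrak{g}\oplus \mathfrak{g}^\ast,\omega,j,\cdot^H)$, with Lie bracket $[\cdot,\cdot]_\ast$, is a special Kähler Lie algebra if and only if $(G,k^+)$ is a flat pseudo-Riemannian Lie group with Levi-Civita connection $\nabla$.
   Context: Construction. For $x\in\mathfrak{g}$ let $x^+$ be the associated left invariant vector field, put $L_x(y)=x\cdot y:=(\nabla_{x^+}y^+)(e)$, let $L^\ast:\mathfrak{g}\to\mathfrak{gl}(\mathfrak{g}^\ast)$, $L_x^\ast(\alpha)=-\alpha\circ L_x$, be the dual representation, and let $k=k^+_e$. For $x,y\in\mathfrak{g}$, $\alpha,\beta\in\mathfrak{g}^\ast$ define: - $[x+\alpha,y+\beta]_\ast=[x,y]+L^\ast_x(\beta)-L^\ast_y(\alpha)$; - $\omega(x+\alpha,y+\beta)=\alpha(y)-\beta(x)$; - $(x+\alpha)\cdot^H(y+\beta)=x\cdot y+L_x^\ast(\beta)$; - $j(x+\alpha)=z_\alpha-k^\flat(x)$, where $k^\flat:\mathfrak{g}\to\mathfrak{g}^\ast$, $k^\flat(x)=k(x,\cdot)$, and $z_\alpha\in\mathfrak{g}$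 is the unique element with $k^\flat(z_\alpha)=\alpha$. Special Kähler Lie algebra: a finite dimensional real Lie algebra $\mathfrak{h}$ with a triple $(\omega,j,\cdot)$ where $\omega$ is a non-degenerate skew-symmetric bilinear form that is a scalar 2-cocycle ($\omega([x,y],z)+\omega([y,z],x)+\omega([z,x],y)=0$); $j$ is an integrable complex structure ($j^2=-\mathrm{Id}$, $[jx,jy]-[x,y]=j[jx,y]+j[x,jy]$); $\cdot$ is a left symmetric product ($x\cdot(y\cdot z)-(x\cdot y)\cdot z=y\cdot(x\cdot z)-(y\cdot x)\cdot z$); and for all $x,y,z$: (i) $k(x,y)=\omega(x,j(y))$ is symmetric and non-degenerate; (ii) $[x,y]=x\cdot y-y\cdot x$; (iii) $\omega(x\cdot y,z)+\omega(y,x\cdot z)=0$; (iv) $j([x,y])=x\cdot j(y)-y\cdot j(x)$. A flat pseudo-Riemannian Lie group is a Lie group with a left invariant pseudo-Riemannian metric whose Levi-Civita connection is flat. *)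

(* Defs.v *)
From HB Require Import structures.
From mathcomp Require Import all_boot all_order all_algebra.
From mathcomp Require Import all_classical all_reals all_analysis.
From mathcomp Require Import ring.
Import Order.TTheory GRing.Theory Num.Theory numFieldNormedType.Exports.

Set Implicit Arguments.
Unset Strict Implicit.
Unset Printing Implicit Defensive.

Local Open Scope classical_set_scope.
Local Open Scope ring_scope.

Section Smooth.
Context {R : realType}.

Section Ck.
Context {V W : normedModType R}.

                                                                            
                                                                
Fixpoint Ck (k : nat) (A : set V) (f : V -> W) : Prop :=
  if k is k'.+1 then
    (forall x, A x -> differentiable f x) /\ (forall v, Ck k' A ('D_v f))
  else forall x, A x -> {for x, continuous f}.

Lemma CkSP k A f : Ck k.+1 A f <->
  (forall x, A x -> differentiable f x) /\ (forall v, Ck k A ('D_v f)).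
Proof. by []. Qed.

Definition smooth_on (A : set V) (f : V -> W) : Prop := forall k, Ck k A f.

End Ck.

Section CkTheory.
Context {V W : normedModType R}.
Implicit Types (A B : set V) (f g : V -> W).

Lemma Ck_local k A f :
  (forall x, A x -> exists2 B : set V, B x & Ck k B f) -> Ck k A f.
Proof.
elim: k f => [|k IH] f h /=; first by move=> x /h[B Bx]; exact.
split=> [x /h[B Bx [+ _]]|v]; first exact.
by apply: IH => x /h[B Bx [_ /(_ v)]]; exists B.
Qed.

Lemma Ck_sub k A B f : A `<=` B -> Ck k B f -> Ck k A f.
Proof. by move=> AB Bf; apply: Ck_local => x /AB; exists B. Qed.

Lemma near_eq_differentiable f g (x : V) : (\near x, f x = g x) ->
  differentiable f x -> differentiable g x.
Proof.
move=> fg [[cf df]].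
suff dg : g = cst (g (lim (nbhs x))) + 'd f x \o center (lim (nbhs x))
    +o_x (center (lim (nbhs x))).
  apply/diffP; apply: (@getPex _ (fun (dg : {linear V -> W}) => continuous dg /\
    forall y, g y = g (lim (nbhs x)) + dg (y - lim (nbhs x))
                  +o_(y \near x) (y - lim (nbhs x)))).
  by exists ('d f x); split => //; rewrite funeqE in dg.
move/eqaddoP: df => df; apply/eqaddoP => e /df {}df.
rewrite lim_id // in df *.
near=> y.
rewrite /= !fctE.
have <- : f y = g y by near: y.
by rewrite -(nbhs_singleton fg); near: y.
Unshelve. all: by end_near. Qed.

Lemma Ck_ext k A f g : open A -> (forall x, A x -> f x = g x) ->
  Ck k A f -> Ck k A g.
Proof.
move=> oA; elim: k f g => [|k IH] f g fg /=.
  move=> fc x Ax; have nfg : \near x, f x = g x.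
    by near=> y; apply: fg; near: y; exact: open_nbhs_nbhs.
  have := fc _ Ax; rewrite /prop_for /continuous_at (nbhs_singleton nfg).
  by apply: cvg_trans; apply: near_eq_cvg.
have nfg x : A x -> \near x, f x = g x.
  by move=> Ax; near=> y; apply: fg; near: y; exact: open_nbhs_nbhs.
move=> [df Df]; split=> [x Ax|v].
  by apply: near_eq_differentiable (df _ Ax); exact: nfg.
by apply: IH (Df v) => x Ax; apply: near_eq_derive; exact: nfg.
Unshelve. all: by end_near. Qed.

Lemma CkS k A f : Ck k.+1 A f -> Ck k A f.
Proof.
elim: k f => [|k IH] f [df Df].
  by move=> x Ax; apply: differentiable_continuous; exact: df.
by split=> // v; apply: IH.
Qed.

Lemma Ck_cst k A (c : W) : Ck k A (cst c).
Proof.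
elim: k c => [|k IH] c /=; first by move=> x _; apply: cst_continuous.
split=> [x _|v]; first exact: differentiable_cst.
by rewrite (_ : 'D_v (cst c) = cst 0) //; apply/funext => x; rewrite derive_cst.
Qed.

Lemma CkD k A f g : open A -> Ck k A f -> Ck k A g -> Ck k A (f \+ g).
Proof.
move=> oA; elim: k f g => [|k IH] f g /=.
  by move=> cf cg x Ax; apply: continuousD; [exact: cf|exact: cg].
move=> [df Df] [dg Dg]; split=> [x Ax|v].
  by apply: differentiableD; [exact: df|exact: dg].
apply: (@Ck_ext _ _ ('D_v f \+ 'D_v g)) => //; last exact: IH.
by move=> x Ax /=; rewrite deriveD //; apply: diff_derivable; [exact: df|exact: dg].
Qed.

End CkTheory.

Lemma Ck_sum (V W : normedModType R) k (A : set V) n (F : 'I_n -> V -> W) :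
  open A -> (forall i, Ck k A (F i)) -> Ck k A (fun x => \sum_i F i x).
Proof.
move=> oA; elim: n F => [|n IH] F FC.
  rewrite (_ : (fun _ => _) = cst 0); first exact: Ck_cst.
  by apply/funext => x; rewrite big_ord0.
rewrite (_ : (fun _ => _) =
    (fun x => \sum_(i < n) F (widen_ord (leqnSn n) i) x) \+ F ord_max).
  by apply: CkD => //; exact: IH.
by apply/funext => x; rewrite big_ord_recr.
Qed.

Lemma CkM (V : normedModType R) k (A : set V) (f g : V -> R) :
  open A -> Ck k A f -> Ck k A g -> Ck k A (f \* g).
Proof.
move=> oA; elim: k f g => [|k IH] f g.
  by move=> cf cg x Ax; apply: cvgM; [exact: cf|exact: cg].
move=> fC gC; have fk := CkS fC; have gk := CkS gC.
move: fC gC => /CkSP[df Df] /CkSP[dg Dg]; apply/CkSP; split=> [x Ax|v].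
  by apply: differentiableM; [exact: df|exact: dg].
apply: (@Ck_ext _ _ _ _ ((f \* 'D_v g) \+ (g \* 'D_v f))) => //.
  move=> x Ax /=; rewrite [RHS]deriveM //; apply: diff_derivable; [exact: df|exact: dg].
by apply: CkD => //; apply: IH.
Qed.

Lemma diff_coord n i (M N : 'rV[R]_n) :
  'd (fun P : 'rV[R]_n => P ord0 i : R) M N = N ord0 i.
Proof.
have @c : {linear 'rV[R]_n -> R}.
  by exists (fun P : 'rV[R]_n => P ord0 i); do 2![eexists]; do ?[constructor];
     rewrite ?mxE// => ? *; rewrite ?mxE//; move=> ?; rewrite !mxE.
rewrite (_ : (fun _ => _) = c) // diff_lin //; exact: coord_continuous.
Qed.

Lemma Ck_coord (V : normedModType R) k (A : set V) n (g : V -> 'rV[R]_n) i :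
  open A -> Ck k A g -> Ck k A (fun x => g x ord0 i).
Proof.
move=> oA; elim: k g => [|k IH] g.
  move=> cg x Ax; apply: (@continuous_comp _ _ _ g (fun M : 'rV[R]_n => M ord0 i)).
    exact: cg.
  exact: coord_continuous.
move=> /CkSP[dg Dg]; apply/CkSP; split=> [x Ax|v].
  apply: (@differentiable_comp _ _ _ _ g (fun M : 'rV[R]_n => M ord0 i)).
    exact: dg.
  exact: differentiable_coord.
apply: (@Ck_ext _ _ _ _ (fun x => ('D_v g x) ord0 i)) => //; last exact: IH.
move=> x Ax; rewrite !deriveE; last first.
- exact: dg.
- apply: (@differentiable_comp _ _ _ _ g (fun M : 'rV[R]_n => M ord0 i)).
    exact: dg.
  exact: differentiable_coord.
rewrite [in RHS](@diff_comp _ _ _ _ g (fun M : 'rV[R]_n => M ord0 i)) /=; last 2 first.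
- exact: dg.
- exact: differentiable_coord.
by rewrite diff_coord.
Qed.

Lemma Ck_comp (V : normedModType R) k (A : set V) n (B : set 'rV[R]_n)
    (g : V -> 'rV[R]_n) (f : 'rV[R]_n -> R) :
  open A -> (forall x, A x -> B (g x)) ->
  Ck k A g -> Ck k B f -> Ck k A (f \o g).
Proof.
move=> oA AB; elim: k f g AB => [|k IH] f g AB.
  move=> cg cf x Ax; apply: continuous_comp; first exact: cg.
  by apply: cf; exact: AB.
move=> gC; have gk := CkS gC; move: gC => /CkSP[dg Dg] /CkSP[df Df]; apply/CkSP; split=> [x Ax|v].
  by apply: differentiable_comp; [exact: dg|apply: df; exact: AB].
apply: (@Ck_ext _ _ _ _ (fun x => \sum_i
    ('D_v g x ord0 i * 'D_(delta_mx ord0 i) f (g x)))) => //; last first.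
  apply: Ck_sum => // i; apply: CkM => //; first exact: Ck_coord.
  by apply: (IH ('D_(delta_mx ord0 i) f) g).
move=> x Ax; have dgx := dg _ Ax; have dfx := df _ (AB _ Ax).
rewrite [RHS]deriveE; last exact: differentiable_comp.
rewrite diff_comp //= -(deriveE v dgx) [in RHS](row_sum_delta ('D_v g x)) linear_sum.
by apply: eq_bigr => i _; rewrite linearZ /= !deriveE.
Qed.

Lemma Ck_slice (V1 V2 W : normedModType R) k (A : set (V1 * V2)) (f : V1 * V2 -> W) c :
  Ck k A f -> Ck k [set x | A (c, x)] (fun x => f (c, x)).
Proof.
have cp x : {for x, continuous (fun x : V2 => (c, x))}.
  by apply: cvg_pair => /=; [exact: cvg_cst|exact: cvg_id].
elim: k f => [|k IH] f.
  move=> cf x /= Ax; apply: (@continuous_comp _ _ _ (fun x => (c, x)) f) => //.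
  exact: cf.
move=> /CkSP[df Df]; apply/CkSP; split=> [x /= Ax|v].
  apply: (@differentiable_comp _ _ _ _ (fun x => (c, x)) f); last exact: df.
  by apply: differentiable_pair; [exact: differentiable_cst|by case: (is_diff_id x)].
rewrite (_ : 'D_v _ = (fun x => 'D_((0, v) : V1 * V2) f (c, x))); first exact: (IH _ (Df _)).
apply/funext => x; rewrite /derive; set F := (fun h => _); set G := (fun h => _).
suff -> : F = G by []. apply/funext => h; rewrite /F /G /=; congr (_ *: (f _ - _)).
by apply: injective_projections; rewrite /= ?scaler0 ?add0r.
Qed.

End Smooth.

Record chart (R : realType) (n : nat) (M : topologicalType) := Chart {
  cdom : set M;
  cimg : set 'rV[R]_n;
  cmap : M -> 'rV[R]_n;
  cinv : 'rV[R]_n -> M;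
  cdom_open : open cdom;
  cimg_open : open cimg;
  cmap_img : forall p, cdom p -> cimg (cmap p);
  cinv_dom : forall u, cimg u -> cdom (cinv u);
  cmapK : forall p, cdom p -> cinv (cmap p) = p;
  cinvK : forall u, cimg u -> cmap (cinv u) = u;
  cmap_continuous : forall p, cdom p -> {for p, continuous cmap};
  cinv_continuous : forall u, cimg u -> {for u, continuous cinv} }.

                                    
HB.mixin Record isManifold (R : realType) (n : nat) M of Topological M := {
  atlas : set (chart R n M);
  atlas_cover : forall p : M, exists2 a, atlas a & cdom a p;
  atlas_smooth : forall a b, atlas a -> atlas b ->
    smooth_on [set u | cimg a u /\ cdom b (cinv a u)] (cmap b \o cinv a);
  manifold_hausdorff : hausdorff_space M;
  manifold_second_countable : @second_countable M }.

#[short(type="manifoldType")]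
HB.structure Definition Manifold (R : realType) (n : nat) :=
  {M of isManifold R n M & Topological M}.

Arguments atlas {R n} M : rename.

Section SmoothFunctions.
Context {R : realType} {n : nat} (M : manifoldType R n).

Definition smooth_fun (f : M -> R) : Prop :=
  forall a, atlas M a -> smooth_on (cimg a) (f \o cinv a).

Definition smooth_pred : {pred M -> R} := fun f => `[< smooth_fun f >].

Lemma smooth_fun_cst (c : R) : smooth_fun (cst c).
Proof. by move=> a _ k; apply: Ck_cst. Qed.

Lemma smooth_funD f g : smooth_fun f -> smooth_fun g -> smooth_fun (f \+ g).
Proof.
by move=> sf sg a Ma k; apply: CkD; [exact: cimg_open|exact: sf|exact: sg].
Qed.

Lemma smooth_funM f g : smooth_fun f -> smooth_fun g -> smooth_fun (f \* g).
Proof.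
by move=> sf sg a Ma k; apply: CkM; [exact: cimg_open|exact: sf|exact: sg].
Qed.

Lemma smooth_subring : subring_closed smooth_pred.
Proof.
split=> [|f g /asboolP sf /asboolP sg|f g /asboolP sf /asboolP sg]; apply/asboolP.
- exact: smooth_fun_cst.
- rewrite (_ : f - g = f \+ (cst (-1) \* g)).
    by apply: smooth_funD => //; apply: smooth_funM => //; exact: smooth_fun_cst.
  by apply/funext => p /=; rewrite mulN1r.
- exact: smooth_funM.
Qed.

                                           
Record Cinf := MkCinf { Cinf_fun :> M -> R; Cinf_subproof : Cinf_fun \in smooth_pred }.

HB.instance Definition _ := [isSub for Cinf_fun].
HB.instance Definition _ := [Choice of Cinf by <:].
HB.instance Definition _ := GRing.SubChoice_isSubComPzRing.Build
  (M -> R) smooth_pred Cinf smooth_subring.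

Lemma CinfP (f : Cinf) : smooth_fun f. Proof. exact/asboolP/Cinf_subproof. Qed.

Definition mkCinf (f : M -> R) (sf : smooth_fun f) : Cinf :=
  MkCinf (introT (asboolP _) sf).

Lemma Cinf_eq (f g : Cinf) : f =1 g -> f = g.
Proof. by move=> fg; apply/val_inj/funext. Qed.

Definition Cinf_scale (a : R) (f : Cinf) : Cinf :=
  mkCinf (smooth_fun_cst a) * f.

Fact Cinf_scaleA a b v : Cinf_scale a (Cinf_scale b v) = Cinf_scale (a * b) v.
Proof. by rewrite /Cinf_scale mulrA; congr (_ * _); exact: Cinf_eq. Qed.
Fact Cinf_scale1 : left_id 1 Cinf_scale.
Proof. by move=> f; rewrite -[RHS]mul1r; congr (_ * _); exact: Cinf_eq. Qed.
Fact Cinf_scaleDr : right_distributive Cinf_scale +%R.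
Proof. by move=> a f g; rewrite /Cinf_scale mulrDr. Qed.
Fact Cinf_scaleDl v : {morph Cinf_scale^~ v : a b / a + b}.
Proof. by move=> a b; rewrite /Cinf_scale -mulrDl; congr (_ * _); exact: Cinf_eq. Qed.

HB.instance Definition _ := GRing.Zmodule_isLmodule.Build R Cinf
  Cinf_scaleA Cinf_scale1 Cinf_scaleDr Cinf_scaleDl.

End SmoothFunctions.

Section VectorFields.
Context {R : realType} {n : nat} (M : manifoldType R n).
Local Notation C := (Cinf M).

Definition derivation (X : C -> C^o) : Prop :=
  (forall (a : R) (f g : C), X (a *: f + g) = a *: (X f : C) + X g) /\
  (forall f g : C, X (f * g) = f * X g + g * X f).

Definition derivation_pred : {pred C -> C^o} := fun X => `[< derivation X >].

Lemma derivation_submod : submod_closed derivation_pred.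
Proof.
split=> [|h X Y /asboolP[Xl XM] /asboolP[Yl YM]]; apply/asboolP; split.
- move=> a f g; have E q : (0 : C -> C^o) q = 0 by [].
  by rewrite !E scaler0 add0r.
- by move=> f g; have E q : (0 : C -> C^o) q = 0 by []; rewrite !E !mulr0 addr0.
- move=> a f g; apply: Cinf_eq => p.
  have := congr1 (fun v : C => v p) (Xl a f g).
  have := congr1 (fun v : C => v p) (Yl a f g).
  change ((Y (a *: f + g) : C) p = a * (Y f : C) p + (Y g : C) p ->
   (X (a *: f + g) : C) p = a * (X f : C) p + (X g : C) p ->
    h p * (X (a *: f + g) : C) p + (Y (a *: f + g) : C) p =
    a * (h p * (X f : C) p + (Y f : C) p) + (h p * (X g : C) p + (Y g : C) p)).
  by move=> -> ->; ring.
- move=> f g; have E q : (h *: X + Y) q = (h : C) * X q + Y q by [].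
  rewrite !E XM YM.
  by ring.
Qed.

HB.instance Definition _ := GRing.isSubmodClosed.Build C (C -> C^o)
  derivation_pred derivation_submod.

                                                                            
                                           
Record vfield := MkVfield
  { vfield_fun :> C -> C^o; vfield_subproof : vfield_fun \in derivation_pred }.

HB.instance Definition _ := [isSub for vfield_fun].
HB.instance Definition _ := [Choice of vfield by <:].
HB.instance Definition _ := [SubChoice_isSubLmodule of vfield by <:].

Definition tangent_derivation (p : M) (u : C -> R^o) : Prop :=
  (forall (a : R) (f g : C), u (a *: f + g) = a * u f + u g) /\
  (forall f g : C, u (f * g) = f p * u g + g p * u f).

Definition tangent_pred p : {pred C -> R^o} := fun u => `[< tangent_derivation p u >].

Lemma tangent_submod p : submod_closed (tangent_pred p).
Proof.
split=> [|c u v /asboolP[ul uM] /asboolP[vl vM]]; apply/asboolP; split.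
- by move=> a f g; have E q : (0 : C -> R^o) q = 0 by []; rewrite !E mulr0 addr0.
- by move=> f g; have E q : (0 : C -> R^o) q = 0 by []; rewrite !E !mulr0 addr0.
- move=> a f g; have E q : (c *: u + v) q = c * u q + v q by [].
  rewrite !E ul vl.
  by ring.
- move=> f g; have E q : (c *: u + v) q = c * u q + v q by [].
  rewrite !E uM vM.
  by ring.
Qed.

HB.instance Definition _ p := GRing.isSubmodClosed.Build R (C -> R^o)
  (tangent_pred p) (tangent_submod p).

                                                                           
                
Record tangent (p : M) := MkTangent
  { tangent_fun :> C -> R^o; tangent_subproof : tangent_fun \in tangent_pred p }.

HB.instance Definition _ p := [isSub for @tangent_fun p].
HB.instance Definition _ p := [Choice of tangent p by <:].
HB.instance Definition _ p := [SubChoice_isSubLmodule of tangent p by <:].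

Lemma vfield_derivation (X : vfield) : derivation X.
Proof. exact/asboolP/vfield_subproof. Qed.

Lemma tangent_tangent_derivation p (u : tangent p) : tangent_derivation p u.
Proof. exact/asboolP/tangent_subproof. Qed.

Definition mkVfield (X : C -> C^o) (dX : derivation X) : vfield :=
  MkVfield (introT (asboolP _) dX).

Definition mkTangent p (u : C -> R^o) (du : tangent_derivation p u) : tangent p :=
  MkTangent (introT (asboolP _) du).

Lemma vfield_at_subproof (X : vfield) (p : M) :
  tangent_derivation p (fun f => (X f : C) p).
Proof.
have [Xl XM] := vfield_derivation X.
by split=> [a f g|f g]; [rewrite Xl|rewrite XM].
Qed.

Definition vfield_at (X : vfield) (p : M) : tangent p :=
  mkTangent (vfield_at_subproof X p).

Lemma lie_bracket_subproof (X Y : vfield) :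
  derivation (fun f => X (Y f) - Y (X f)).
Proof.
have [Xl XM] := vfield_derivation X; have [Yl YM] := vfield_derivation Y.
split=> [a f g|f g].
  by rewrite Xl Yl Xl Yl scalerBr opprD addrACA.
have XD u v : X (u + v) = X u + X v by have := Xl 1 u v; rewrite !scale1r.
have YD u v : Y (u + v) = Y u + Y v by have := Yl 1 u v; rewrite !scale1r.
by rewrite XM YM XD YD !XM !YM; ring.
Qed.

Definition lie_bracket (X Y : vfield) : vfield :=
  mkVfield (lie_bracket_subproof X Y).

Record connection := Connection {
  nabla :> vfield -> vfield -> vfield;
  nabla_linear_l : forall (f : C) X Y Z,
    nabla (f *: X + Y) Z = f *: nabla X Z + nabla Y Z;
  nablaD_r : forall X Y Z, nabla X (Y + Z) = nabla X Y + nabla X Z;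
  nabla_leibniz : forall (f : C) X Y,
    nabla X (f *: Y) = (X f : C) *: Y + f *: nabla X Y }.

Definition torsion_free (D : connection) : Prop :=
  forall X Y, D X Y - D Y X = lie_bracket X Y.

Definition flat (D : connection) : Prop :=
  forall X Y Z, D X (D Y Z) - D Y (D X Z) - D (lie_bracket X Y) Z = 0.

Record pseudo_metric := PseudoMetric {
  pmetric :> forall p : M, tangent p -> tangent p -> R;
  pmetric_linear : forall p (a : R) (u v w : tangent p),
    pmetric (a *: u + v) w = a * pmetric u w + pmetric v w;
  pmetric_sym : forall p (u v : tangent p), pmetric u v = pmetric v u;
  pmetric_nondegenerate : forall p (u : tangent p),
    (forall v, pmetric u v = 0) -> u = 0;
  pmetric_smooth : forall X Y : vfield,
    smooth_fun (fun p => pmetric (vfield_at X p) (vfield_at Y p)) }.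

Definition pmetric_fun (k : pseudo_metric) (X Y : vfield) : C :=
  mkCinf (pmetric_smooth k X Y).

Definition metric_connection (k : pseudo_metric) (D : connection) : Prop :=
  forall X Y Z : vfield,
    X (pmetric_fun k Y Z) = pmetric_fun k (D X Y) Z + pmetric_fun k Y (D X Z).

Definition levi_civita (k : pseudo_metric) (D : connection) : Prop :=
  torsion_free D /\ metric_connection k D.

End VectorFields.

HB.mixin Record isLieGroup (R : realType) (n : nat) G
    of Manifold R n G & Group G := {
  mulg_continuous : continuous (fun x : G * G => (x.1 * x.2)%g);
  mulg_smooth : forall a b c, atlas G a -> atlas G b -> atlas G c ->
    smooth_on
      [set u : 'rV[R]_n * 'rV[R]_n | [/\ cimg a u.1, cimg b u.2 &
                              cdom c (cinv a u.1 * cinv b u.2)%g]]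
      (fun u => cmap c (cinv a u.1 * cinv b u.2)%g);
  invg_continuous : continuous (fun x : G => (x^-1)%g);
  invg_smooth : forall a b, atlas G a -> atlas G b ->
    smooth_on [set u | cimg a u /\ cdom b ((cinv a u)^-1)%g]
      (fun u => cmap b ((cinv a u)^-1)%g) }.

#[short(type="lieGroupType")]
HB.structure Definition LieGroup (R : realType) (n : nat) :=
  {G of isLieGroup R n G & Manifold R n G & Group G}.

Section LieGroupGeometry.
Context {R : realType} {n : nat} (G : lieGroupType R n).
Local Notation C := (Cinf G).

Lemma smooth_ltrans (g : G) (f : C) : smooth_fun (fun x => f (g * x)%g).
Proof.
move=> c Gc k; apply: Ck_local => u0 cu0.
have [a Ga ag] := atlas_cover g.
have [d Gd dg] := atlas_cover (g * cinv c u0)%g.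
have gC : continuous (fun x : G => (g * x)%g).
  move=> x; apply: (@continuous_comp _ _ _ (fun x => (g, x))
    (fun x : G * G => (x.1 * x.2)%g)); last exact: mulg_continuous.
  by apply: cvg_pair => /=; [exact: cvg_cst|exact: cvg_id].
pose B := [set u | cimg c u /\ cdom d (g * cinv c u)%g].
have oB : open B.
  rewrite openE => u [cu du]; apply: filterI.
    by apply: open_nbhs_nbhs; split=> //; exact: cimg_open.
  have gcu : {for u, continuous (fun u => (g * cinv c u)%g)}.
    by apply: continuous_comp; [exact: cinv_continuous|exact: gC].
  by apply: gcu; apply: open_nbhs_nbhs; split=> //; exact: cdom_open.
exists B => //.
apply: (@Ck_ext _ _ _ _ _ ((f \o cinv d) \o
    (fun u => cmap d (cinv a (cmap a g) * cinv c u)%g))) => //.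
  by move=> u [cu du] /=; rewrite cmapK // cmapK.
apply: (@Ck_comp _ _ _ _ _ (cimg d)) => //; last exact: CinfP.
  by move=> u [cu du]; rewrite cmapK //; exact: cmap_img.
have := Ck_slice (cmap a g) (mulg_smooth _ _ _ Ga Gc Gd k).
apply: Ck_sub => u [cu du]; split=> //=; first exact: cmap_img.
by rewrite cmapK.
Qed.

Definition ltrans (g : G) (f : C) : C := mkCinf (smooth_ltrans g f).

Lemma lpush_subproof (g : G) (X : vfield G) :
  derivation (fun f => ltrans (g^-1)%g (X (ltrans g f))).
Proof.
have [Xl XM] := vfield_derivation X.
have lD h u v : ltrans h (u + v) = ltrans h u + ltrans h v by exact: Cinf_eq.
have lZ h (a : R) u : ltrans h (a *: u) = a *: ltrans h u by exact: Cinf_eq.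
have lM h u v : ltrans h (u * v) = ltrans h u * ltrans h v by exact: Cinf_eq.
have lK u : ltrans (g^-1)%g (ltrans g u) = u.
  by apply: Cinf_eq => x /=; rewrite mulgA mulgV mul1g.
split=> [a f h|f h]; first by rewrite lD lZ Xl lD lZ.
by rewrite lM XM lD !lM !lK.
Qed.

                                                             
Definition lpush (g : G) (X : vfield G) : vfield G :=
  mkVfield (lpush_subproof g X).

Lemma ldiff_subproof (g p : G) (u : tangent p) :
  tangent_derivation (g * p)%g (fun f => u (ltrans g f)).
Proof.
have [ul uM] := tangent_tangent_derivation u.
split=> [a f h|f h].
  by rewrite -ul; congr (u _); exact: Cinf_eq.
by rewrite -[f _]/(ltrans g f p) -[h (g * p)%g]/(ltrans g h p) -uM; congr (u _); exact: Cinf_eq.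
Qed.

                                           
Definition ldiff (g p : G) (u : tangent p) : tangent (g * p)%g :=
  mkTangent (ldiff_subproof g u).

Definition left_invariant_vfield (X : vfield G) : Prop :=
  forall g, lpush g X = X.

Definition left_invariant_connection (D : connection G) : Prop :=
  forall g X Y, lpush g (D X Y) = D (lpush g X) (lpush g Y).

Definition left_invariant_metric (k : pseudo_metric G) : Prop :=
  forall (g p : G) (u v : tangent p), k (g * p)%g (ldiff g u) (ldiff g v) = k p u v.

Definition flat_pseudo_riemannian_lie_group (k : pseudo_metric G) : Prop :=
  left_invariant_metric k /\ exists2 D, levi_civita k D & flat D.

                                                                                
                                                                                 
                                                                            
                                                                                   
Record lie_algebra_of (g : vectType R) := LieAlgebraOf {
  tan1 : g -> tangent (1%g : G);
  tan1_inv : tangent (1%g : G) -> g;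
  tan1_linear : linear tan1;
  tan1K : cancel tan1 tan1_inv;
  tan1_invK : cancel tan1_inv tan1;
  lvfield : g -> vfield G;
  lvfield_invariant : forall x, left_invariant_vfield (lvfield x);
  lvfield_at1 : forall x, vfield_at (lvfield x) 1%g = tan1 x }.

End LieGroupGeometry.

Definition path_connected (R : realType) (T : topologicalType) : Prop :=
  forall x y : T, exists c : R -> T,
    [/\ {within `[0, 1], continuous c}, c 0 = x & c 1 = y].

Definition simply_connected (R : realType) (T : topologicalType) : Prop :=
  path_connected R T /\
  forall c : R -> T, {within `[0, 1], continuous c} -> c 0 = c 1 ->
    exists H : R * R -> T,
      [/\ {within `[0, 1]%classic `*` `[0, 1]%classic, continuous H},
          forall t, t \in `[0, 1] -> H (0, t) = c t,
          forall t, t \in `[0, 1] -> H (1, t) = c 0 &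
          forall s, s \in `[0, 1] -> H (s, 0) = c 0 /\ H (s, 1) = c 0].

Section SpecialKahler.
Context {R : realType} (h : vectType R).
Implicit Types (br mul : h -> h -> h) (om : h -> h -> R) (j : h -> h).

Definition bilinear_map (V : lmodType R) (b : h -> h -> V) : Prop :=
  (forall x, linear (b x)) /\ (forall y, linear (b^~ y)).

Definition bilinear_form om : Prop := @bilinear_map R^o om.

Definition lie_algebra br : Prop :=
  [/\ bilinear_map br, forall x, br x x = 0 &
      forall x y z, br x (br y z) + br y (br z x) + br z (br x y) = 0].

Definition nondegenerate om : Prop :=
  forall x, (forall y, om x y = 0) -> x = 0.

Definition scalar_2cocycle br om : Prop :=
  forall x y z, om (br x y) z + om (br y z) x + om (br z x) y = 0.

Definition integrable_complex_structure br j : Prop :=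
  [/\ linear j, forall x, j (j x) = - x &
      forall x y, br (j x) (j y) - br x y = j (br (j x) y) + j (br x (j y))].

Definition left_symmetric mul : Prop :=
  bilinear_map mul /\
  forall x y z, mul x (mul y z) - mul (mul x y) z =
                mul y (mul x z) - mul (mul y x) z.

Record special_kahler_lie_algebra br om j mul : Prop := SpecialKahler {
  sk_lie : lie_algebra br;
  sk_bilinear : bilinear_form om;
  sk_skew : forall x y, om x y = - om y x;
  sk_nondegenerate : nondegenerate om;
  sk_cocycle : scalar_2cocycle br om;
  sk_complex : integrable_complex_structure br j;
  sk_left_symmetric : left_symmetric mul;
  sk_metric_sym : forall x y, om x (j y) = om y (j x);
  sk_metric_nondegenerate : nondegenerate (fun x y => om x (j y));
  sk_bracket : forall x y, br x y = mul x y - mul y x;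
  sk_symplectic : forall x y z, om (mul x y) z + om y (mul x z) = 0;
  sk_special : forall x y, j (br x y) = mul x (j y) - mul y (j x) }.

End SpecialKahler.

Section CotangentConstruction.
Context {R : realType} {n : nat} {G : lieGroupType R n} {g : vectType R}.
Context (L : lie_algebra_of G g) (D : connection G) (k : pseudo_metric G).

Local Notation dual := 'Hom(g, R^o).
Local Notation h := (g * dual)%type.

Definition gbracket (x y : g) : g :=
  tan1_inv L (vfield_at (lie_bracket (lvfield L x) (lvfield L y)) 1%g).

Definition gprod (x y : g) : g :=
  tan1_inv L (vfield_at (D (lvfield L x) (lvfield L y)) 1%g).

Definition gmetric (x y : g) : R := k 1%g (tan1 L x) (tan1 L y).

                                                                               
                                                                         
Definition gprod_dual (x : g) (alpha : dual) : dual :=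
  linfun (fun y => - alpha (gprod x y)).

Definition flat_map (x : g) : dual := linfun (gmetric x : g -> R^o).

                                                                            
                     
Definition sharp_map (alpha : dual) : g := xget 0 [set z | flat_map z = alpha].

                                               
Definition bracket_star (a b : h) : h :=
  (gbracket a.1 b.1, gprod_dual a.1 b.2 - gprod_dual b.1 a.2).

Definition omega_star (a b : h) : R := a.2 b.1 - b.2 a.1.

Definition prod_H (a b : h) : h := (gprod a.1 b.1, gprod_dual a.1 b.2).

Definition j_star (a : h) : h := (sharp_map a.2, - flat_map a.1).

End CotangentConstruction.

(* Main.v *)
Require Import Defs.
From mathcomp Require Import all_boot all_order all_algebra.
From mathcomp Require Import all_classical all_reals all_analysis.
From HB Require Import structures.
From mathcomp Require Import ring.

(** Both sides of the equivalence say that left multiplications are skew for the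
    metric at the identity: with [x ** y] the product of [g] and [<<x, y>>] the
    value of [k] at the identity,
      [<<x ** y, z>> + <<y, x ** z>> = 0]  for all [x, y, z].      (S)

    Geometry: (S) is equivalent to [nabla k = 0] ([metric_connection_gprod]).
    On left invariant fields [k] is constant and [D] is given by the product,
    so there [nabla k] is minus the left side of (S).  The passage to
    arbitrary fields uses that [nabla k] is linear over the smooth functions in
    its three arguments, and that left invariant fields generate all fields over
    these functions ([vfield_span_ind]).  The coefficients are smooth because
    nondegeneracy of [k] turns the coordinates of a field [Y] in a left invariant
    frame into functions [k(Y, Z)] with [Z] left invariant, and these are smooth
    by the definition of a metric.

    Algebra: if the cotangent algebra is special Kaehler, the first component of
    [j [a, b] = a . j b - b . j a], for [a = x] in [g] and [b = <<y, .>>] in the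
    dual of [g], is the equality of [x ** y] with the vector representing
    [- <<y, x ** .>>], which is (S) ([special_kahler_gprod]).  Conversely (S) says
    that [<<., .>>] intertwines [L_x] with its dual representation.  Writing the
    elements of [g + g^*] as [(x, <<u, .>>)], i.e. as pairs [(x, u)] in [g + g],
    all operations become explicit:
      [(x, u) . (y, v) = (x ** y, x ** v)],   [j (x, u) = (u, - x)],
      [omega ((x, u), (y, v)) = <<u, y>> - <<v, x>>],
    and each axiom follows from bilinearity, left symmetry, symmetry of the
    metric and (S) ([gprod_special_kahler]). *)

Set Implicit Arguments.
Unset Strict Implicit.
Unset Printing Implicit Defensive.

Import GRing.Theory.
Local Open Scope classical_set_scope.
Local Open Scope ring_scope.

(** * Linear maps given as plain functions *)

Section LinearMaps.
Context {R : pzRingType} {U V : lmodType R} (f : U -> V).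
Hypothesis fl : linear f.

Lemma linear_fun0 : f 0 = 0.
Proof.
by have /eqP := fl 1 0 0; rewrite !scale1r addr0 -subr_eq0 opprD addNKr oppr_eq0 => /eqP.
Qed.

Lemma linear_funD : {morph f : x y / x + y}.
Proof. by move=> x y; have := fl 1 x y; rewrite !scale1r. Qed.

Lemma linear_funZ a : {morph f : x / a *: x}.
Proof. by move=> x; have := fl a x 0; rewrite linear_fun0 !addr0. Qed.

Lemma linear_funN : {morph f : x / - x}.
Proof. by move=> x; rewrite -!scaleN1r linear_funZ. Qed.

Lemma linear_fun_sum m (F : 'I_m -> U) : f (\sum_i F i) = \sum_i f (F i).
Proof. exact: (big_morph f linear_funD linear_fun0). Qed.

End LinearMaps.

Lemma linfun_linearE (R : fieldType) (aT rT : vectType R) (f : aT -> rT) :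
  linear f -> linfun f =1 f.
Proof.
move=> fl; pose F : {linear aT -> rT} :=
  HB.pack f (GRing.isLinear.Build R aT rT _ f fl).
exact: (lfunE F).
Qed.

(** * Values of vector fields *)

Section PointValues.
Context {R : realType} {n : nat} (M : manifoldType R n).
Implicit Types (X Y : vfield M) (p : M).

Lemma vfield_ext X Y :
  (forall f p, (X f : Cinf M) p = (Y f : Cinf M) p) -> X = Y.
Proof. by move=> XY; apply/val_inj/funext => f; apply: Cinf_eq => p; apply: XY. Qed.

Lemma vfield_eq X Y : (forall p, vfield_at X p = vfield_at Y p) -> X = Y.
Proof.
move=> XY; apply: vfield_ext => f p.
exact: (congr1 (fun u : tangent p => u f) (XY p)).
Qed.

Lemma tangent_eq p (u v : tangent p) : u =1 v -> u = v.
Proof. by move=> uv; apply/val_inj/funext. Qed.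

Lemma vfield_atD X Y p : vfield_at (X + Y) p = vfield_at X p + vfield_at Y p.
Proof. exact: tangent_eq. Qed.

Lemma vfield_atZ (f : Cinf M) X p : vfield_at (f *: X) p = f p *: vfield_at X p.
Proof. exact: tangent_eq. Qed.

Definition Cinf_cst (a : R) : Cinf M := mkCinf (smooth_fun_cst (M := M) a).

Lemma derivation_cst X a : X (Cinf_cst a) = 0.
Proof.
have [Xl XM] := vfield_derivation X.
have X1 : X 1 = 0 :> Cinf M.
  have := XM 1 1; rewrite !mul1r => /eqP.
  by rewrite -subr_eq0 opprD addrA subrr sub0r oppr_eq0 => /eqP.
have X0 : X 0 = 0 :> Cinf M.
  have := XM 0 0; rewrite !mul0r addr0 //.
have -> : Cinf_cst a = a *: (1 : Cinf M) + 0.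
  by apply: Cinf_eq => p /=; rewrite mulr1 addr0.
by rewrite Xl X1 X0 scaler0 addr0.
Qed.

Variable k : pseudo_metric M.

Lemma pmetric_funC X Y : pmetric_fun k X Y = pmetric_fun k Y X.
Proof. by apply: Cinf_eq => p /=; rewrite pmetric_sym. Qed.

Lemma pmetric_funDl X Y Z :
  pmetric_fun k (X + Y) Z = pmetric_fun k X Z + pmetric_fun k Y Z.
Proof.
apply: Cinf_eq => p /=; rewrite vfield_atD -[vfield_at X p]scale1r pmetric_linear.
by rewrite mul1r.
Qed.

Lemma pmetric_funZl (f : Cinf M) X Z :
  pmetric_fun k (f *: X) Z = f * pmetric_fun k X Z.
Proof.
apply: Cinf_eq => p /=; rewrite vfield_atZ.
exact: (@linear_funZ R (tangent p) R^o ((@k p)^~ _)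
  (fun a u v => pmetric_linear k a u v _) (f p)).
Qed.

End PointValues.

(** * Left invariant fields *)

Section LeftInvariance.
Context {R : realType} {n : nat} (G : lieGroupType R n).
Implicit Types (X Y : vfield G).

(** Left translation by [p] carries the value at the identity to the value at
    [p], so the former determines the field. *)
Lemma left_invariant_at X (p : G) (f : Cinf G) : left_invariant_vfield X ->
  (X f : Cinf G) p = (X (ltrans p f) : Cinf G) 1%g.
Proof.
move=> /(_ p) pX; rewrite -{1}pX /=.
by rewrite -[LHS]/((X (ltrans p f) : Cinf G) (p^-1 * p)%g) mulVg.
Qed.

Lemma left_invariant_eq X Y :
  left_invariant_vfield X -> left_invariant_vfield Y ->
  vfield_at X 1%g = vfield_at Y 1%g -> X = Y.
Proof.
move=> iX iY XY; apply: vfield_ext => f p.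
rewrite (left_invariant_at _ _ iX) (left_invariant_at _ _ iY).
exact: (congr1 (fun u : tangent (1%g : G) => u (ltrans p f)) XY).
Qed.

Lemma left_invariantD X Y : left_invariant_vfield X ->
  left_invariant_vfield Y -> left_invariant_vfield (X + Y).
Proof.
move=> iX iY p; rewrite -{2}(iX p) -{2}(iY p).
by apply: vfield_ext.
Qed.

Lemma left_invariantZ (a : R) X : left_invariant_vfield X ->
  left_invariant_vfield (Cinf_cst G a *: X).
Proof.
move=> iX p; rewrite -{2}(iX p).
by apply: vfield_ext.
Qed.

Lemma left_invariant_bracket X Y : left_invariant_vfield X ->
  left_invariant_vfield Y -> left_invariant_vfield (lie_bracket X Y).
Proof.
move=> iX iY p; rewrite -{2}(iX p) -{2}(iY p).
apply: vfield_ext => f q /=.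
have lK u : ltrans p (ltrans (p^-1)%g u) = u.
  by apply: Cinf_eq => x /=; rewrite mulgA mulVg mul1g.
by rewrite !lK.
Qed.

Lemma left_invariant_metric_cst (k : pseudo_metric G) X Y :
  left_invariant_metric k -> left_invariant_vfield X ->
  left_invariant_vfield Y ->
  pmetric_fun k X Y = Cinf_cst G (k 1%g (vfield_at X 1%g) (vfield_at Y 1%g)).
Proof.
move=> ik iX iY; apply: Cinf_eq => p /=.
(* Stated at [p * 1], since [tangent (p * 1)] and [tangent p] are distinct types. *)
have E Z : left_invariant_vfield Z ->
    ldiff p (vfield_at Z 1%g) = vfield_at Z (p * 1)%g.
  move=> iZ; apply: tangent_eq => f.
  have Zf : (Z f : Cinf G) (p * 1)%g = (Z (ltrans p f) : Cinf G) 1%g.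
    by rewrite mulg1 (left_invariant_at _ _ iZ).
  exact: esym Zf.
by have := ik p 1%g (vfield_at X 1%g) (vfield_at Y 1%g); rewrite !E // mulg1.
Qed.

Context {g : vectType R} (L : lie_algebra_of G g).

Lemma lvfield_tan1_inv X : left_invariant_vfield X ->
  lvfield L (tan1_inv L (vfield_at X 1%g)) = X.
Proof.
move=> iX; apply: left_invariant_eq => //; first exact: lvfield_invariant.
by rewrite lvfield_at1 tan1_invK.
Qed.

Lemma lvfieldD x y : lvfield L (x + y) = lvfield L x + lvfield L y.
Proof.
apply: left_invariant_eq; first exact: lvfield_invariant.
  by apply: left_invariantD; exact: lvfield_invariant.
by rewrite vfield_atD !lvfield_at1 (linear_funD (tan1_linear L)).
Qed.

Lemma lvfieldZ a x : lvfield L (a *: x) = Cinf_cst G a *: lvfield L x.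
Proof.
apply: left_invariant_eq; first exact: lvfield_invariant.
  by apply: left_invariantZ; exact: lvfield_invariant.
by rewrite vfield_atZ !lvfield_at1 (linear_funZ (tan1_linear L)).
Qed.

Lemma lvfield_inj : injective (lvfield L).
Proof.
by move=> x y xy; rewrite -(tan1K L x) -(tan1K L y) -!lvfield_at1 xy.
Qed.

(** The translate of [u] to the identity, [f |-> u (f (p^-1 .))], is a
    tangent vector there, hence the value of a left invariant field. *)
Lemma tangent_lvfield p (u : tangent p) :
  exists x, vfield_at (lvfield L x) p = u.
Proof.
have [ul uM] := tangent_tangent_derivation u.
have dw : tangent_derivation (1%g : G) (fun f => u (ltrans (p^-1)%g f)).
  have E (f : Cinf G) : f 1%g = ltrans (p^-1)%g f p by rewrite /= mulVg.
  split=> [a f h|f h].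
    by rewrite -ul; congr (u _); exact: Cinf_eq.
  by rewrite !E -uM; congr (u _); exact: Cinf_eq.
exists (tan1_inv L (mkTangent dw)); apply: tangent_eq => f.
rewrite -[LHS]/((lvfield L (tan1_inv L (mkTangent dw)) f : Cinf G) p).
rewrite left_invariant_at; last exact: lvfield_invariant.
rewrite -[LHS]/(vfield_at _ 1%g (ltrans p f)) lvfield_at1 tan1_invK /=.
by congr (u _); apply: Cinf_eq => x /=; rewrite mulgA mulgV mul1g.
Qed.

End LeftInvariance.

(** * The product and the metric of the Lie algebra *)

Section CotangentLieAlgebra.
Context {R : realType} {n : nat} {G : lieGroupType R n} {g : vectType R}.
Context (L : lie_algebra_of G g) (D : connection G) (k : pseudo_metric G).
Hypotheses (hD : left_invariant_connection D) (hDflat : flat D).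
Hypotheses (hDtors : torsion_free D) (hk : left_invariant_metric k).

Local Notation dual := 'Hom(g, R^o).
Local Notation h := (g * dual)%type.
Local Notation "x ** y" := (gprod L D x y) (at level 40, left associativity).
Local Notation "[ x ~ y ]" := (gbracket L x y) (at level 0).
Local Notation "<< x , y >>" := (gmetric L k x y).
Local Notation lv := (lvfield L).
Local Notation flat_map := (flat_map L k).
Local Notation sharp_map := (sharp_map L k).

Lemma lvfield_gprod x y : lv (x ** y) = D (lv x) (lv y).
Proof.
apply: lvfield_tan1_inv => p.
by rewrite hD !(@lvfield_invariant _ _ _ _ L).
Qed.

Lemma lvfield_gbracket x y : lv [x ~ y] = lie_bracket (lv x) (lv y).
Proof.
by apply: lvfield_tan1_inv; apply: left_invariant_bracket; exact: lvfield_invariant.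
Qed.

Lemma gbracketE x y : [x ~ y] = x ** y - y ** x.
Proof.
apply: (@lvfield_inj _ _ _ _ L); rewrite lvfield_gbracket -hDtors.
apply/eqP; rewrite subr_eq; apply/eqP.
by rewrite -!lvfield_gprod -lvfieldD subrK.
Qed.

Lemma gprod_linear_r x : linear (gprod L D x).
Proof.
move=> a y z; apply: (@lvfield_inj _ _ _ _ L).
rewrite lvfield_gprod !lvfieldD !lvfieldZ nablaD_r nabla_leibniz !lvfield_gprod.
by rewrite derivation_cst scale0r add0r.
Qed.

Lemma gprod_linear_l y : linear ((gprod L D)^~ y).
Proof.
move=> a x z; apply: (@lvfield_inj _ _ _ _ L).
by rewrite lvfield_gprod !lvfieldD !lvfieldZ nabla_linear_l !lvfield_gprod.
Qed.

Lemma gprod_flat x y z : x ** (y ** z) - y ** (x ** z) = [x ~ y] ** z.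
Proof.
apply/eqP; rewrite subr_eq; apply/eqP; apply: (@lvfield_inj _ _ _ _ L).
rewrite lvfieldD !lvfield_gprod lvfield_gbracket.
apply/eqP; rewrite -subr_eq -subr_eq0.
by rewrite hDflat.
Qed.

Let gprodDr x := linear_funD (gprod_linear_r x).
Let gprodNr x := linear_funN (gprod_linear_r x).
Let gprodZr x a := linear_funZ (gprod_linear_r x) a.
Let gprodDl x y z : (x + y) ** z = x ** z + y ** z.
Proof. exact: (linear_funD (gprod_linear_l z)). Qed.
Let gprodNl x z : (- x) ** z = - (x ** z).
Proof. exact: (linear_funN (gprod_linear_l z)). Qed.
Let gprodZl a x z : (a *: x) ** z = a *: (x ** z).
Proof. exact: (linear_funZ (gprod_linear_l z) a). Qed.
Let gprodE := (gprodDr, gprodNr, gprodZr, gprodDl, gprodNl, gprodZl).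

(** Flatness and vanishing torsion make the product left symmetric. *)
Lemma gprod_lsa x y z :
  x ** (y ** z) = x ** y ** z - y ** x ** z + y ** (x ** z).
Proof.
by apply/eqP; rewrite -subr_eq gprod_flat gbracketE gprodDl gprodNl.
Qed.

Lemma gmetric_linear_l y : linear ((gmetric L k)^~ y : g -> R^o).
Proof. by move=> a x z; rewrite /gmetric tan1_linear pmetric_linear. Qed.

Lemma gmetricC x y : <<x, y>> = <<y, x>>.
Proof. exact: pmetric_sym. Qed.

Lemma gmetric_linear_r x : linear (gmetric L k x : g -> R^o).
Proof. by move=> a y z; rewrite ![gmetric L k x _]gmetricC; apply: gmetric_linear_l. Qed.

Let gmetricDl x y z : <<x + y, z>> = <<x, z>> + <<y, z>>.
Proof. exact: (linear_funD (gmetric_linear_l z)). Qed.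
Let gmetricNl x z : <<- x, z>> = - <<x, z>>.
Proof. exact: (linear_funN (gmetric_linear_l z)). Qed.
Let gmetricZl a x z : <<a *: x, z>> = a * <<x, z>>.
Proof. exact: (linear_funZ (gmetric_linear_l z) a). Qed.
Let gmetricDr x y z : <<x, y + z>> = <<x, y>> + <<x, z>>.
Proof. exact: (linear_funD (gmetric_linear_r x)). Qed.
Let gmetricNr x z : <<x, - z>> = - <<x, z>>.
Proof. exact: (linear_funN (gmetric_linear_r x)). Qed.
Let gmetricZr a x z : <<x, a *: z>> = a * <<x, z>>.
Proof. exact: (linear_funZ (gmetric_linear_r x) a). Qed.
Let gmetric0l z : <<0, z>> = 0.
Proof. exact: (linear_fun0 (gmetric_linear_l z)). Qed.
Let gmetricE :=
  (gmetricDl, gmetricNl, gmetricZl, gmetricDr, gmetricNr, gmetricZr, gmetric0l).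

Lemma gmetric_nondegenerate x : (forall z, <<x, z>> = 0) -> x = 0.
Proof.
move=> x0; apply: (can_inj (@tan1K _ _ _ _ L)).
rewrite (linear_fun0 (tan1_linear L)); apply: (@pmetric_nondegenerate _ _ _ k 1%g) => v.
by rewrite -(tan1_invK L v); apply: x0.
Qed.

Lemma gmetric_eq x y : (forall z, <<x, z>> = <<y, z>>) -> x = y.
Proof.
move=> xy; apply/eqP; rewrite -subr_eq0; apply/eqP/gmetric_nondegenerate => z.
by rewrite gmetricDl gmetricNl xy subrr.
Qed.

Lemma flat_mapE x y : flat_map x y = <<x, y>>.
Proof. exact: (linfun_linearE (gmetric_linear_r x)). Qed.

Lemma flat_map_linear : linear flat_map.
Proof.
by move=> a x y; apply/lfunP => z; rewrite lfunE /= lfunE /= !flat_mapE !gmetricE.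
Qed.

Lemma flat_map_inj : injective flat_map.
Proof. by move=> x y xy; apply: gmetric_eq => z; rewrite -!flat_mapE xy. Qed.

(** An injective linear map between spaces of equal dimension. *)
Lemma flat_map_surj (alpha : dual) : exists x, flat_map x = alpha.
Proof.
pose F := linfun flat_map.
have FE : F =1 flat_map by apply: linfun_linearE; exact: flat_map_linear.
have kF : lker F = 0%VS.
  by apply/eqP/lker0P => x y; rewrite !FE; exact: flat_map_inj.
have : (limg F == fullv)%VS.
  rewrite eqEdim subvf /= limg_dim_eq ?kF ?capv0 // !dimvf.
  by rewrite /dim /= muln1.
move=> /eqP F_full; have /memv_imgP[x _ ->] : alpha \in limg F.
  by rewrite F_full memvf.
by exists x; rewrite FE.
Qed.

Lemma flat_mapK : cancel flat_map sharp_map.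
Proof. by move=> x; apply: xget_unique => // y /flat_map_inj. Qed.

Lemma gprod_dualE x (alpha : dual) y :
  gprod_dual L D x alpha y = - alpha (x ** y).
Proof.
apply: (@linfun_linearE _ _ _ (fun y => - alpha (x ** y) : R^o)) => a u v.
by rewrite gprodDr gprodZr linearP /= opprD scalerN.
Qed.

(** * Left invariant frames and metric connections *)

Lemma pmetric_lvfield x y : pmetric_fun k (lv x) (lv y) = Cinf_cst G <<x, y>>.
Proof.
rewrite left_invariant_metric_cst //; try exact: lvfield_invariant.
by rewrite !lvfield_at1.
Qed.

(** Left invariant fields generate all fields over the smooth functions: if the
    [e i] form a basis and [<<., z i>>] is the [i]-th coordinate, then
    [Y = \sum_i k(Y, lv (z i)) *: lv (e i)]. *)
Lemma vfield_span_ind (P : vfield G -> Prop) :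
  (forall x, P (lv x)) ->
  (forall (f : Cinf G) Y Z, P Y -> P Z -> P (f *: Y + Z)) -> forall Y, P Y.
Proof.
move=> Plv Pcomb Y.
have P0 : P 0.
  by have := Pcomb (-1) _ _ (Plv 0) (Plv 0); rewrite scaleN1r addNr.
pose m := \dim {:g}; pose e := vbasis {:g}.
have [i|z zE] := @choice _ _
    (fun (i : 'I_m) z => forall x, coord e i x = <<x, z>>).
  have [z zE] := flat_map_surj (linfun (coord e i : g -> R^o)).
  by exists z => x; rewrite gmetricC -flat_mapE zE lfunE.
have -> : Y = \sum_(i < m) pmetric_fun k Y (lv (z i)) *: lv e`_i.
  apply: vfield_eq => p.
  have [x xE] := tangent_lvfield L (vfield_at Y p).
  pose F y := vfield_at (lv y) p.
  have F_linear : linear F.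
    by move=> a y w; rewrite /F lvfieldD lvfieldZ vfield_atD vfield_atZ.
  have lvp0 : vfield_at 0 p = 0 by exact: tangent_eq.
  rewrite (big_morph _ (fun X Z => vfield_atD X Z p) lvp0) -xE -/(F x).
  rewrite [in LHS](coord_vbasis (memvf x)) (linear_fun_sum F_linear).
  apply: eq_bigr => i _; rewrite vfield_atZ (linear_funZ F_linear) zE /=.
  by rewrite -xE -[k p _ _]/(pmetric_fun k (lv x) (lv (z i)) p) pmetric_lvfield.
by elim/big_rec: _ => // i Z _ PZ; apply: Pcomb.
Qed.

(** The covariant derivative [(nabla_X k)(Y, Z)]. *)
Definition nabla_metric (X Y Z : vfield G) : Cinf G :=
  (X (pmetric_fun k Y Z) : Cinf G)
  - (pmetric_fun k (D X Y) Z + pmetric_fun k Y (D X Z)).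

Lemma nabla_metricC X Y Z : nabla_metric X Y Z = nabla_metric X Z Y.
Proof.
rewrite /nabla_metric (pmetric_funC k Y Z) (pmetric_funC k _ Z) (pmetric_funC k Y).
by rewrite [X in _ - X]addrC.
Qed.

Lemma nabla_metric_combl (f : Cinf G) X X' Y Z :
  nabla_metric (f *: X + X') Y Z = f * nabla_metric X Y Z + nabla_metric X' Y Z.
Proof.
rewrite /nabla_metric.
have -> : ((f *: X + X') (pmetric_fun k Y Z) : Cinf G) =
  f * (X (pmetric_fun k Y Z) : Cinf G) + X' (pmetric_fun k Y Z) by [].
rewrite !nabla_linear_l ![pmetric_fun k Y (_ + _)]pmetric_funC.
rewrite !pmetric_funDl !pmetric_funZl ![pmetric_fun k _ Y]pmetric_funC.
by ring.
Qed.

Lemma nabla_metric_combr (f : Cinf G) X Y Y' Z :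
  nabla_metric X (f *: Y + Y') Z = f * nabla_metric X Y Z + nabla_metric X Y' Z.
Proof.
have [Xl XM] := vfield_derivation X.
have XD u v : X (u + v) = X u + X v by have := Xl 1 u v; rewrite !scale1r.
rewrite /nabla_metric nablaD_r nabla_leibniz !(pmetric_funDl, pmetric_funZl) XD XM.
by ring.
Qed.

(** [nabla k] is a tensor, so it vanishes as soon as it does on left invariant
    fields, where [k] is constant. *)
Lemma metric_connection_gprod : metric_connection k D <->
  (forall x y z, <<x ** y, z>> + <<y, x ** z>> = 0).
Proof.
have dE x y z : nabla_metric (lv x) (lv y) (lv z) =
    - Cinf_cst G (<<x ** y, z>> + <<y, x ** z>>).
  rewrite /nabla_metric -!lvfield_gprod !pmetric_lvfield derivation_cst sub0r.
  by congr (- _); exact: Cinf_eq.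
split=> [kD x y z|S X Y Z].
  have := dE x y z; rewrite /nabla_metric kD subrr => /eqP.
  rewrite eq_sym oppr_eq0 => /eqP E.
  exact: (congr1 (fun f : Cinf G => f 1%g) E).
suff : nabla_metric X Y Z = 0 by move=> /eqP; rewrite subr_eq0 => /eqP.
have c0 : Cinf_cst G 0 = 0 by exact: Cinf_eq.
move: X Y Z; apply: vfield_span_ind => [x|f X X' HX HX' Y Z]; last first.
  by rewrite nabla_metric_combl HX HX' mulr0 addr0.
apply: vfield_span_ind => [y|f Y Y' HY HY' Z]; last first.
  by rewrite nabla_metric_combr HY HY' mulr0 addr0.
apply: vfield_span_ind => [z|f Z Z' HZ HZ']; last first.
  by rewrite nabla_metricC nabla_metric_combr !(nabla_metricC _ _ (lv y)) HZ HZ' mulr0 addr0.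
by rewrite dE S c0 oppr0.
Qed.

(** * Special Kaehler structures and the metric *)

(** The compatibility of [j] with the product, on an element of [g] and an
    element of its dual, is already (S). *)
Lemma special_kahler_gprod :
  special_kahler_lie_algebra
    (bracket_star L D) (@omega_star R g) (j_star L k) (prod_H L D) ->
  forall x y z, <<x ** y, z>> + <<y, x ** z>> = 0.
Proof.
move=> [] _ _ _ _ _ _ _ _ _ _ _ spec x y z.
have := congr1 fst (spec (x, 0) (0, flat_map y)).
rewrite /= flat_mapK (linear_fun0 (gprod_linear_l _)) subr0.
have -> : gprod_dual L D x (flat_map y) - gprod_dual L D 0 0 =
          gprod_dual L D x (flat_map y).
  apply/lfunP => w; rewrite lfunE /= lfunE /= !gprod_dualE.
  by rewrite lfunE /= oppr0 subr0.
have [w wE] := flat_map_surj (gprod_dual L D x (flat_map y)).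
rewrite -wE flat_mapK => wx.
by rewrite -wx -flat_mapE wE gprod_dualE flat_mapE addNr.
Qed.

Section FromMetricProduct.
Hypothesis S : forall x y z, <<x ** y, z>> + <<y, x ** z>> = 0.

Let gprod_skew p q r : <<p ** q, r>> = - <<q, p ** r>>.
Proof. by apply/eqP; rewrite -addr_eq0 S. Qed.

(** In these coordinates the dual representation is again [L], and [j] is the
    standard complex structure of [g + g]. *)
Let mk (x u : g) : h := (x, flat_map u).

Let mkP (a : h) : exists x u, a = mk x u.
Proof. by case: a => x al; have [u <-] := flat_map_surj al; exists x, u. Qed.

Let mkD x u y v : mk x u + mk y v = mk (x + y) (u + v).
Proof. by rewrite /mk (linear_funD flat_map_linear). Qed.
Let mkN x u : - mk x u = mk (- x) (- u).
Proof. by rewrite /mk (linear_funN flat_map_linear). Qed.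
Let mkZ a x u : a *: mk x u = mk (a *: x) (a *: u).
Proof. by rewrite /mk (linear_funZ flat_map_linear). Qed.
Let mk0 : mk 0 0 = 0.
Proof. by rewrite /mk (linear_fun0 flat_map_linear). Qed.

(** (S) in the form: the metric intertwines [L_x] with its dual. *)
Let dual_flat x u : gprod_dual L D x (flat_map u) = flat_map (x ** u).
Proof.
by apply/lfunP => z; rewrite gprod_dualE !flat_mapE gprod_skew.
Qed.

Let prod_mk x u y v : prod_H L D (mk x u) (mk y v) = mk (x ** y) (x ** v).
Proof. by rewrite /prod_H /= dual_flat. Qed.
Let bracket_mk x u y v :
  bracket_star L D (mk x u) (mk y v) = mk (x ** y - y ** x) (x ** v - y ** u).
Proof.
rewrite /bracket_star /= !dual_flat gbracketE.
by rewrite /mk (linear_funD flat_map_linear) (linear_funN flat_map_linear).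
Qed.
Let j_mk x u : j_star L k (mk x u) = mk u (- x).
Proof. by rewrite /j_star /= flat_mapK /mk (linear_funN flat_map_linear). Qed.
Let omega_mk x u y v : omega_star (mk x u) (mk y v) = <<u, y>> - <<v, x>>.
Proof. by rewrite /omega_star /= !flat_mapE. Qed.
Let mkE := (prod_mk, bracket_mk, j_mk, omega_mk, mkD, mkN, mkZ).

(** In the coordinates [mk], vector identities are tested against all
    [<<., r>>], where bilinearity and left symmetry turn them into ring
    identities between scalars. *)
Lemma gprod_special_kahler : special_kahler_lie_algebra
    (bracket_star L D) (@omega_star R g) (j_star L k) (prod_H L D).
Proof.
split.
- split.
  + split=> a t b c; have [x [u ->]] := mkP a; have [y [v ->]] := mkP b;
      have [z [w ->]] := mkP c; rewrite !mkE !gprodE; congr mk;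
      by apply: gmetric_eq => r; rewrite !gmetricE; ring.
  + by move=> a; have [x [u ->]] := mkP a; rewrite mkE !subrr mk0.
  + move=> a b c; have [x [u ->]] := mkP a; have [y [v ->]] := mkP b;
      have [z [w ->]] := mkP c; rewrite !mkE !gprodE -mk0; congr mk.
      apply: gmetric_eq => r; rewrite (gprod_lsa x y z) (gprod_lsa y z x).
      by rewrite (gprod_lsa z x y) !gmetricE; ring.
    apply: gmetric_eq => r; rewrite (gprod_lsa x y w) (gprod_lsa y z u).
    by rewrite (gprod_lsa z x v) !gmetricE; ring.
- split=> a t b c; have [x [u ->]] := mkP a; have [y [v ->]] := mkP b;
      have [z [w ->]] := mkP c; rewrite !mkE !gmetricE /GRing.scale /=; ring.
- move=> a b; have [x [u ->]] := mkP a; have [y [v ->]] := mkP b.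
  by rewrite !mkE; ring.
- move=> a; have [x [u ->]] := mkP a => H; rewrite -mk0; congr mk.
    apply: gmetric_nondegenerate => v; have := H (mk 0 v).
    by rewrite mkE gmetricC gmetric0l sub0r gmetricC => /eqP; rewrite oppr_eq0 => /eqP.
  apply: gmetric_nondegenerate => y; have := H (mk y 0).
  by rewrite mkE gmetric0l subr0.
- move=> a b c; have [x [u ->]] := mkP a; have [y [v ->]] := mkP b;
      have [z [w ->]] := mkP c; rewrite !mkE !gmetricE.
  by rewrite !gprod_skew; ring.
- split=> [t a b|a|a b].
  + have [x [u ->]] := mkP a; have [y [v ->]] := mkP b.
    by rewrite !mkE; congr mk; rewrite opprD scalerN.
  + by have [x [u ->]] := mkP a; rewrite !mkE.
  + have [x [u ->]] := mkP a; have [y [v ->]] := mkP b.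
    rewrite !mkE ?gprodE; congr mk;
      by apply: gmetric_eq => r; rewrite !gmetricE; ring.
- split.
  + split=> a t b c; have [x [u ->]] := mkP a; have [y [v ->]] := mkP b;
      by have [z [w ->]] := mkP c; rewrite !mkE !gprodE.
  + move=> a b c; have [x [u ->]] := mkP a; have [y [v ->]] := mkP b;
      have [z [w ->]] := mkP c; rewrite !mkE; congr mk.
      by apply: gmetric_eq => r; rewrite (gprod_lsa x y z) !gmetricE; ring.
    by apply: gmetric_eq => r; rewrite (gprod_lsa x y w) !gmetricE; ring.
- move=> a b; have [x [u ->]] := mkP a; have [y [v ->]] := mkP b.
  by rewrite !mkE !gmetricE (gmetricC v u) (gmetricC y x); ring.
- move=> a; have [x [u ->]] := mkP a => H; rewrite -mk0; congr mk.
    apply: gmetric_nondegenerate => y; have := H (mk y 0).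
    by rewrite !mkE !gmetricE (gmetricC u) gmetric0l opprK add0r gmetricC.
  apply: gmetric_nondegenerate => v; have := H (mk 0 v).
  by rewrite !mkE !gmetricE oppr0 subr0.
- move=> a b; have [x [u ->]] := mkP a; have [y [v ->]] := mkP b.
  by rewrite !mkE.
- move=> a b c; have [x [u ->]] := mkP a; have [y [v ->]] := mkP b;
      have [z [w ->]] := mkP c; rewrite !mkE.
  by rewrite !gprod_skew; ring.
- move=> a b; have [x [u ->]] := mkP a; have [y [v ->]] := mkP b.
  by rewrite !mkE !gprodE; congr mk; rewrite opprD.
Qed.

End FromMetricProduct.
End CotangentLieAlgebra.

Theorem theorem3p2 (R : realType) (n : nat) (G : lieGroupType R n)
    (hG : simply_connected R G)
    (g : vectType R) (L : lie_algebra_of G g)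
    (D : connection G) (hD : left_invariant_connection D)
    (hDflat : flat D) (hDtors : torsion_free D)
    (k : pseudo_metric G) (hk : left_invariant_metric k) :
  special_kahler_lie_algebra
    (bracket_star L D) (@omega_star R g) (j_star L k) (prod_H L D) <->
  flat_pseudo_riemannian_lie_group k /\ levi_civita k D.
Proof.
split=> [sk|[_ [_ kD]]].
  have kD : metric_connection k D.
    apply/(metric_connection_gprod L hD hk).
    exact: (special_kahler_gprod hD sk).
  by split; [split=> //; exists D|].
apply: gprod_special_kahler => //.
exact/(metric_connection_gprod L hD hk).
Qed.
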